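(* Let $G$ be a group and let $\mathcal{A}$ be a Boolean (left) $G$-algebra of subsets of $G$ which is also a right $G$-algebra (i.e. closed under right translations by elements of $G$). Then for the ambit $(G,S(\mathcal{A}),p_e)$ the properties DRP and WDRP are equivalent.
   Context: A Boolean (left) $G$-algebra of subsets of $G$ is a Boolean algebra of subsets of $G$ closed under left translations by elements of $G$. $S(\mathcal{A})$ is its Stone space of ultrafilters, on which the (discrete) group $G$ acts by left translations: $gp=\{gA: A\in p\}$; $p_e=\{A\in\mathcal{A}: e\in A\}$ has dense orbit, so $(G,S(\mathcal{A}),p_e)$ is a $0$-dimensional ambit, i.e. a compact Hausdorff $0$-dimensional space with a continuous $G$-action and a distinguished point with dense orbit. For a $0$-dimensional ambit $(G,X,x_0)$: a coloring is a function $c\colon G\to 2^n$, $n\ge 1$. For $S\subseteq X$, $c$ is $S$-definable if there are clopen sets $U_0,\dots,U_{n-1}\subseteq X$ and points $y_0,\dots,y_{n-1}\in S$ such that for all $g\in G$, $i<n$: $c(g)(i)=1$ if $y_i\in gU_i$ and $c(g)(i)=0$ if $y_i\notin gU_i$. The ambit has $S$-DRP if for every $S$-definable coloring $c\colon G\to 2^n$, every $k\ge 1$ and every $k$-element $A\subseteq G$ there is $h\in G$ such that $|c[hA]|=1$. WDRP and DRP mean $S$-DRP for $S=\{x_0\}$ and $S=Gx_0$, respectively. *)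

(* Defs.v *)
From HB Require Import structures.
From mathcomp Require Import all_boot.
From mathcomp Require Import all_classical topology.

Set Implicit Arguments.
Unset Strict Implicit.
Unset Printing Implicit Defensive.

Local Open Scope classical_set_scope.
Local Open Scope card_scope.
Local Open Scope group_scope.

Section Translates.
Variable G : groupType.
Implicit Types (g h a : G) (B C : set G).

Definition ltrans g B : set G := [set g * x | x in B].
Definition rtrans B g : set G := [set x * g | x in B].

Lemma ltransE g B a : ltrans g B a = B (g^-1 * a).
Proof.
apply/propext; split=> [[x Bx <-]|Ba]; first by rewrite mulKg.
by exists (g^-1 * a) => //; rewrite mulVKg.
Qed.

Lemma ltrans1 B : ltrans 1 B = B.
Proof. by apply/funext => a; rewrite ltransE invg1 mul1g. Qed.

Lemma ltransM g h B : ltrans (g * h) B = ltrans g (ltrans h B).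
Proof. by apply/funext => a; rewrite !ltransE invgM mulgA. Qed.

Lemma ltransK g : cancel (ltrans g) (ltrans g^-1).
Proof. by move=> B; rewrite -ltransM mulVg ltrans1. Qed.

Lemma ltransVK g : cancel (ltrans g^-1) (ltrans g).
Proof. by move=> B; rewrite -ltransM mulgV ltrans1. Qed.

Lemma ltransI g B C : ltrans g (B `&` C) = ltrans g B `&` ltrans g C.
Proof. by apply/funext => a; rewrite /setI /mkset /= !ltransE. Qed.

Lemma ltransC g B : ltrans g (~` B) = ~` ltrans g B.
Proof. by apply/funext => a; rewrite /setC /mkset /= !ltransE. Qed.

Lemma ltransT g : ltrans g [set: G] = [set: G].
Proof. by apply/funext => a; rewrite ltransE. Qed.

Lemma ltransS g B C : B `<=` C -> ltrans g B `<=` ltrans g C.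
Proof. exact: image_subset. Qed.

End Translates.

(* Only maps [act g] are required to be continuous: [G] is discrete. *)
Record ambit (G : groupType) := Ambit {
  ambit_space :> topologicalType;
  act : G -> ambit_space -> ambit_space;
  base_point : ambit_space;
  act1 : forall x, act 1 x = x;
  actM : forall g h x, act (g * h) x = act g (act h x);
  act_continuous : forall g, continuous (act g);
  ambit_compact : compact [set: ambit_space];
  ambit_hausdorff : hausdorff_space ambit_space;
  ambit_zero_dim : basis (@clopen ambit_space);
  ambit_dense : dense [set act g base_point | g in [set: G]];
}.

Section DRP.
Variables (G : groupType) (X : ambit G).

Definition base_orbit : set X := [set act g (base_point X) | g in [set: G]].

(* [c g i] is the i-th bit of the color c(g) in 2^n; [act g @` U i] is g U_i. *)
Definition definable (S : set X) n (c : G -> {ffun 'I_n -> bool}) : Prop :=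
  exists (U : 'I_n -> set X) (y : 'I_n -> X),
    [/\ forall i, clopen (U i), forall i, S (y i) &
        forall g i, c g i <-> (act g @` U i) (y i)].

Definition S_DRP (S : set X) : Prop :=
  forall n (c : G -> {ffun 'I_n -> bool}), (1 <= n)%N -> definable S c ->
  forall k (A : set G), (1 <= k)%N -> A #= `I_k ->
  exists h : G, c @` ltrans h A #= `I_1.

Definition WDRP : Prop := S_DRP [set base_point X].
Definition DRP : Prop := S_DRP base_orbit.

End DRP.

Record Galgebra (G : groupType) := GAlgebra {
  galg_sets :> set G -> Prop;
  galg0 : galg_sets set0;
  galgU : forall B C, galg_sets B -> galg_sets C -> galg_sets (B `|` C);
  galgC : forall B, galg_sets B -> galg_sets (~` B);
  galg_ltrans : forall g B, galg_sets B -> galg_sets (ltrans g B);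
}.

Section Stone.
Variables (G : groupType) (A : Galgebra G).

Lemma galgI B C : A B -> A C -> A (B `&` C).
Proof.
move=> AB AC; rewrite -[_ `&` _]setCK setCI.
by apply/galgC/galgU; apply: galgC.
Qed.

Lemma galgT : A [set: G].
Proof. by rewrite -setC0; apply/galgC/galg0. Qed.

(* [p] is an ultrafilter of the Boolean algebra [A] itself, not of the power set
   of [G] (compare [UltraFilter]). *)
Record is_ultrafilter (p : set (set G)) : Prop := IsUltrafilter {
  uf_sub : p `<=` A;
  ufT : p [set: G];
  uf0 : ~ p set0;
  ufI : forall B C, p B -> p C -> p (B `&` C);
  ufS : forall B C, p B -> A C -> B `<=` C -> p C;
  uf_max : forall B, A B -> p B \/ p (~` B);
}.

Record stone := Stone { uf :> set G -> Prop; ufP : is_ultrafilter uf }.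

HB.instance Definition _ := gen_eqMixin stone.
HB.instance Definition _ := gen_choiceMixin stone.

Lemma stone_eq (p q : stone) : uf p = uf q -> p = q.
Proof.
by case: p q => [p Pp] [q Pq] /= pq; subst q; rewrite (Prop_irrelevance Pp Pq).
Qed.

Lemma ufC (p : stone) B : A B -> p (~` B) <-> ~ p B.
Proof.
move=> AB; split=> [pCB pB|npB]; last by case: (uf_max (ufP p) AB).
by apply: (uf0 (ufP p)); rewrite -(setICr B); apply: (ufI (ufP p)).
Qed.

Definition stone_base (B : set G) : set stone := [set p | p B].

Lemma stone_base_cover : \bigcup_(B in galg_sets A) stone_base B = setT.
Proof.
by apply/seteqP; split=> // p _; exists setT; [exact: galgT|exact: ufT (ufP p)].
Qed.

Lemma stone_base_join B C p : A B -> A C -> stone_base B p -> stone_base C p ->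
  exists D, [/\ A D, stone_base D p &
    stone_base D `<=` stone_base B `&` stone_base C].
Proof.
move=> AB AC pB pC; exists (B `&` C); split; first exact: galgI.
  exact: (ufI (ufP p)).
by move=> q qBC; split; apply: (ufS (ufP q) qBC) => // x [].
Qed.

HB.instance Definition _ :=
  isBaseTopological.Build stone stone_base_cover stone_base_join.

Lemma stone_base_open B : A B -> open (stone_base B).
Proof.
by move=> AB; exists [set B]; [move=> _ -> | rewrite bigcup_set1].
Qed.

Lemma stone_base_clopen B : A B -> clopen (stone_base B).
Proof.
move=> AB; split; first exact: stone_base_open.
rewrite -[stone_base B]setCK; apply: open_closedC.
rewrite (_ : ~` _ = stone_base (~` B)); first by apply/stone_base_open/galgC.
by apply/seteqP; split=> p /(ufC p AB).
Qed.

Lemma stone_nbhsP (p : stone) (V : set stone) :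
  nbhs p V <-> exists B, p B /\ stone_base B `<=` V.
Proof.
split=> [|[B [pB BV]]].
  rewrite nbhsE => -[O [[D DA <-] [B DB pB]] OV].
  by exists B; split=> // q qB; apply: OV; exists B.
rewrite nbhsE; exists (stone_base B) => //; split => //.
by apply/stone_base_open/(uf_sub (ufP p)).
Qed.

Lemma stone_base_nbhs (p : stone) B : p B -> nbhs p (stone_base B).
Proof. by move=> pB; apply/stone_nbhsP; exists B; split. Qed.

Lemma stone_hausdorff : hausdorff_space stone.
Proof.
have sub (p q : stone) : cluster (nbhs p) q -> uf p `<=` uf q.
  move=> pq B pB; have AB := uf_sub (ufP p) pB.
  apply: contrapT => /(ufC q AB) qB.
  have [r [rB rCB]] := pq _ _ (stone_base_nbhs pB) (stone_base_nbhs qB).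
  exact: ((ufC r AB).1 rCB).
move=> p q pq; apply: stone_eq; apply/seteqP; split; first exact: sub.
by apply: sub => U V pU qV; rewrite setIC; apply: pq.
Qed.

Lemma stone_compact : compact [set: stone].
Proof.
rewrite compact_ultra => F UF _.
pose p := [set B | A B /\ F (stone_base B)].
have Pp : is_ultrafilter p.
  split.
  - by move=> B [].
  - split; first exact: galgT.
    by apply: filterS filterT => q _; exact: ufT (ufP q).
  - case=> _ F0; apply: (@filter_not_empty _ F _).
    by apply: filterS F0 => q /(uf0 (ufP q)).
  - move=> B C [AB FB] [AC FC]; split; first exact: galgI.
    by apply: filterS2 FB FC => q; apply: (ufI (ufP q)).
  - move=> B C [AB FB] AC BC; split=> //.
    by apply: filterS FB => q qB; apply: (ufS (ufP q) qB).
  - move=> B AB; have [FB|FB] := in_ultra_setVsetC (stone_base B) UF.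
      by left.
    by right; split; [exact: galgC|apply: filterS FB => q /(ufC q AB)].
exists (Stone Pp); split=> // V /stone_nbhsP[B [[_ FB] BV]].
exact: filterS FB.
Qed.

Lemma stone_zero_dim : basis (@clopen stone).
Proof.
split=> [V [] //|p V /stone_nbhsP[B [pB BV]]].
exists (stone_base B) => //; split=> //.
by apply/stone_base_clopen/(uf_sub (ufP p)).
Qed.

Lemma uf_transE g (p : set (set G)) B :
  (ltrans g @` p) B = p (ltrans g^-1 B).
Proof.
apply/propext; split=> [[C pC <-]|pB]; first by rewrite ltransK.
by exists (ltrans g^-1 B) => //; rewrite ltransVK.
Qed.

Lemma uf_trans_subproof g (p : stone) : is_ultrafilter (ltrans g @` p).
Proof.
split.
- by move=> _ [B pB <-]; apply/galg_ltrans/(uf_sub (ufP p)).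
- by rewrite uf_transE ltransT; exact: ufT (ufP p).
- by rewrite uf_transE [ltrans _ _]image_set0; exact: uf0 (ufP p).
- by move=> B C; rewrite !uf_transE ltransI; apply: (ufI (ufP p)).
- move=> B C; rewrite !uf_transE => pB AC BC.
  by apply: (ufS (ufP p) pB); [exact: galg_ltrans|exact: ltransS].
- move=> B AB; rewrite !uf_transE ltransC.
  by apply: (uf_max (ufP p)); exact: galg_ltrans.
Qed.

Definition stone_act g (p : stone) : stone := Stone (uf_trans_subproof g p).

Lemma stone_actE g p B : stone_act g p B = p (ltrans g^-1 B).
Proof. exact: uf_transE. Qed.

Lemma principal_subproof : is_ultrafilter [set B | A B /\ B 1].
Proof.
split=> //=.
- by move=> B [].
- by split => //; exact: galgT.
- by case.
- by move=> B C [AB B1] [AC C1]; split; [exact: galgI|split].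
- by move=> B C [AB B1] AC BC; split=> //; apply: BC.
- move=> B AB; have [B1|nB1] := pselect (B 1); first by left.
  by right; split=> //; apply: galgC.
Qed.

(* This is p_e. *)
Definition stone_principal : stone := Stone principal_subproof.

Lemma stone_act1 p : stone_act 1 p = p.
Proof.
by apply: stone_eq; apply/funext => B; rewrite stone_actE invg1 ltrans1.
Qed.

Lemma stone_actM g h p : stone_act (g * h) p = stone_act g (stone_act h p).
Proof.
by apply: stone_eq; apply/funext => B; rewrite !stone_actE invgM ltransM.
Qed.

Lemma stone_act_continuous g : continuous (stone_act g).
Proof.
move=> p V /stone_nbhsP[B [pB BV]]; apply/stone_nbhsP.
exists (ltrans g^-1 B); split; first by rewrite -stone_actE.
by move=> q qB; apply: BV; rewrite /stone_base /mkset stone_actE.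
Qed.

Lemma stone_dense :
  dense [set stone_act g stone_principal | g in [set: G]].
Proof.
move=> V [p Vp] oV.
have /stone_nbhsP[B [pB BV]] : nbhs p V by exact: open_nbhs_nbhs.
have AB := uf_sub (ufP p) pB.
have [g Bg] : B !=set0.
  by apply/set0P/eqP => B0; apply: (uf0 (ufP p)); rewrite -B0.
exists (stone_act g stone_principal); split; last by exists g.
apply: BV; rewrite /stone_base /mkset stone_actE; split.
  exact: galg_ltrans.
by rewrite ltransE invgK mulg1.
Qed.

Definition stone_ambit : ambit G :=
  Ambit stone_act1 stone_actM stone_act_continuous stone_compact
    stone_hausdorff stone_zero_dim stone_dense.

End Stone.

(* Main.v *)
Require Import Defs.
From mathcomp Require Import all_boot.
From mathcomp Require Import all_classical topology.

(** Since the base orbit contains the base point, DRP implies WDRP in every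
    ambit.  The converse rests on the right translations of the Stone space.
    Because [A] is closed under right translations, an ultrafilter [p] can be
    moved to [p h], consisting of the sets [B h] with [B] in [p].  This map is
    continuous, it commutes with the left action of [G], and it sends [p_e] to
    [h p_e], as the translates of the trivial coset agree on both sides.  So
    every point of the base orbit is the image of [p_e] under a continuous
    equivariant self-map of the ambit ([stone_rtrans_equivariant],
    [stone_rtrans_principal]).

    Given such maps [f], a coloring read off from clopen sets [U_i] at the points
    [y_i = f_i p_e] is also read off from the clopen sets [f_i^-1 U_i] at [p_e]
    alone: [f p_e] lies in [g U] iff [f (g^-1 p_e) = g^-1 (f p_e)] lies in [U],
    that is, iff [p_e] lies in [g (f^-1 U)].  Hence the two definability
    conditions single out the same colorings ([definable_base_point]). *)

Set Implicit Arguments.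
Unset Strict Implicit.
Unset Printing Implicit Defensive.

Local Open Scope classical_set_scope.
Local Open Scope group_scope.

Section DefinableColorings.
Variables (G : groupType) (X : ambit G).

Lemma act_imageE (g : G) (U : set X) (x : X) :
  (act g @` U) x <-> U (act g^-1 x).
Proof.
split=> [[u Uu <-]|Ux]; first by rewrite -actM mulVg act1.
by exists (act g^-1 x); rewrite -?actM ?mulgV ?act1.
Qed.

Lemma definable_sub (S T : set X) n (c : G -> {ffun 'I_n -> bool}) :
  S `<=` T -> definable S c -> definable T c.
Proof.
by move=> ST [U [y [clU Sy cE]]]; exists U, y; split=> // i; apply: ST.
Qed.

Lemma S_DRP_sub (S T : set X) : S `<=` T -> S_DRP T -> S_DRP S.
Proof. by move=> ST drpT n c n1 /(definable_sub ST); apply: drpT. Qed.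

(** Continuous equivariant self-maps pull the witnessing clopen sets back, so the
    points where they are tested can all be moved to the base point. *)
Lemma definable_base_point (S : set X) n (c : G -> {ffun 'I_n -> bool}) :
  (forall y, S y -> exists f : X -> X,
    [/\ continuous f, forall g x, f (act g x) = act g (f x) &
        f (base_point X) = y]) ->
  definable S c -> definable [set base_point X] c.
Proof.
move=> Sf [U [y [clU Sy cE]]].
have [f fP] := choice (fun i => Sf _ (Sy i)).
exists (fun i => f i @^-1` U i), (fun=> base_point X); split=> // [i|g i].
  have [f_cont _ _] := fP i; have [oU cU] := clU i.
  by split; [apply: open_comp|apply: closed_comp] => // x _; exact: f_cont.
have [_ f_equiv f_base] := fP i.
by rewrite cE !act_imageE /preimage /mkset f_equiv f_base.
Qed.

End DefinableColorings.

Section RightTranslations.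
Variables (G : groupType) (A : Galgebra G).
Hypothesis A_rtrans : forall (g : G) (B : set G), A B -> A (rtrans B g).

Lemma rtransE (B : set G) (g a : G) : rtrans B g a = B (a * g^-1).
Proof.
apply/propext; split=> [[x Bx <-]|Ba]; first by rewrite mulgK.
by exists (a * g^-1) => //; rewrite mulgVK.
Qed.

Lemma rtransVK (B : set G) (g : G) : rtrans (rtrans B g^-1) g = B.
Proof. by apply/funext => a; rewrite !rtransE invgK mulgVK. Qed.

Lemma ltrans_rtrans (g h : G) (B : set G) :
  ltrans g (rtrans B h) = rtrans (ltrans g B) h.
Proof. by apply/funext => a; rewrite !(ltransE, rtransE) mulgA. Qed.

(** The translate [p h] is written as a preimage rather than as the image of [p]
    under [C |-> C h], so that the Boolean conditions on [p h] become those on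
    [p]; closure of [A] under right translations keeps [p h] inside [A] and makes
    it decide every member of [A]. *)
Lemma uf_rtrans_subproof (h : G) (p : stone A) :
  is_ultrafilter A [set B | p (rtrans B h^-1)].
Proof.
split=> /=.
- by move=> B pB; rewrite -(rtransVK B h); apply/A_rtrans/(uf_sub (ufP p)).
- rewrite (_ : rtrans _ _ = setT); first exact: ufT (ufP p).
  by apply/funext => a; rewrite rtransE.
- by rewrite [rtrans _ _]image_set0; exact: uf0 (ufP p).
- move=> B C pB pC.
  rewrite (_ : rtrans _ _ = rtrans B h^-1 `&` rtrans C h^-1).
    exact: (ufI (ufP p)).
  by apply/funext => a; rewrite /setI /mkset /= !rtransE.
- move=> B C pB AC BC; apply: (ufS (ufP p) pB); first exact: A_rtrans.
  exact: image_subset.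
- move=> B AB; rewrite (_ : rtrans (~` B) _ = ~` rtrans B h^-1).
    by apply: (uf_max (ufP p)); exact: A_rtrans.
  by apply/funext => a; rewrite /setC /mkset /= !rtransE.
Qed.

Definition stone_rtrans (h : G) (p : stone A) : stone A :=
  Stone (uf_rtrans_subproof h p).

Lemma stone_rtrans_continuous (h : G) : continuous (stone_rtrans h).
Proof.
move=> p V /stone_nbhsP[B [pB BV]]; apply/stone_nbhsP.
by exists (rtrans B h^-1); split=> // q qB; apply: BV.
Qed.

(** Left and right translations of subsets of [G] commute by associativity, and
    so do the induced maps on ultrafilters. *)
Lemma stone_rtrans_equivariant (h g : G) (p : stone A) :
  stone_rtrans h (stone_act g p) = stone_act g (stone_rtrans h p).
Proof.
apply: stone_eq; apply/funext => B; rewrite stone_actE.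
change (stone_act g p (rtrans B h^-1) = p (rtrans (ltrans g^-1 B) h^-1)).
by rewrite stone_actE ltrans_rtrans.
Qed.

(** Both sides are the ultrafilter of the members of [A] that contain [h]. *)
Lemma stone_rtrans_principal (h : G) :
  stone_rtrans h (stone_principal A) = stone_act h (stone_principal A).
Proof.
apply: stone_eq; apply/funext => B; rewrite stone_actE.
apply/propext; rewrite /= /mkset rtransE ltransE !invgK mul1g mulg1.
split=> -[AB Bh]; split=> //.
  by apply: galg_ltrans; rewrite -(rtransVK B h); exact: A_rtrans.
by apply: A_rtrans; rewrite -(ltransVK h B); exact: galg_ltrans.
Qed.

End RightTranslations.

Theorem corollary3p11 (G : groupType) (A : Galgebra G)
    (A_rtrans : forall (g : G) (B : set G), A B -> A (rtrans B g)) :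
  DRP (stone_ambit A) <-> WDRP (stone_ambit A).
Proof.
split=> [|wdrp n c n1 c_def].
  by apply: S_DRP_sub => _ ->; exists 1 => //; exact: act1.
apply: wdrp => //; apply: definable_base_point c_def => _ [h _ <-].
exists (stone_rtrans A_rtrans h); split.
- exact: stone_rtrans_continuous.
- exact: stone_rtrans_equivariant.
- exact: stone_rtrans_principal.
Qed.
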